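(* Let $f:\mathbb{R}^d\to\mathbb{R}$ be differentiable and $M$-smooth ($M\ge 0$ a scalar), and let $\bar z$ be a stationary point of $f$ ($\nabla f(\bar z)=0$). Let $s$ be standardized on $\mathbb{R}^d$ with $\mathbb{E}[\mathsf{u}_i^4]=\kappa<\infty$, and for $w=(m,C)$ let $\mathsf{g}=\nabla_w f(T_w(\mathsf{u}))$ with $\mathsf{u}\sim s$. Then \[ \mathbb{E}\|\mathsf{g}\|_2^2\le M^2\Big((d+1)\|m-\bar z\|_2^2+(d+\kappa)\|C\|_F^2\Big). \] Moreover, the bound is unimprovable: for every $M\ge0$ and every $\bar z\in\mathbb{R}^d$, the function $f(z)=\frac{M}{2}\|z-\bar z\|_2^2$ satisfies the hypotheses and attains equality for every $w=(m,C)$.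
   Context: $f$ is $M$-smooth if $\|\nabla f(y)-\nabla f(z)\|_2\le M\|y-z\|_2$ for all $y,z\in\mathbb{R}^d$. $T_w(u)=Cu+m$ for $w=(m,C)$, $m\in\mathbb{R}^d$, $C\in\mathbb{R}^{d\times d}$, with $w$ regarded as the vector of all $d+d^2$ entries; $\nabla_w$ is the gradient with respect to all these entries and $\|\cdot\|_2$ on it is the Euclidean norm over all entries. A distribution $s$ on $\mathbb{R}^d$ is standardized if for $\mathsf{u}\sim s$ the components are i.i.d. with $\mathbb{E}\mathsf{u}_1=\mathbb{E}\mathsf{u}_1^3=0$ and $\mathrm{Var}(\mathsf{u}_1)=1$. $\|\cdot\|_F$ is the Frobenius norm. *)

(* Defs.v *)
From HB Require Import structures.
From mathcomp Require Import all_boot all_order all_algebra.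
From mathcomp Require Import all_classical all_reals all_analysis.
Set Implicit Arguments. Unset Strict Implicit. Unset Printing Implicit Defensive.
Import Order.TTheory GRing.Theory Num.Theory.
Import numFieldNormedType.Exports.
Local Open Scope classical_set_scope.
Local Open Scope ring_scope.

Section defs.
Variables (R : realType) (d : nat).

(* Euclidean norm of a column vector of R^d (the library norm on matrices is
   the max-norm, so we define the Euclidean one explicitly). *)
Definition enorm (v : 'cV[R]_d) : R := Num.sqrt (\sum_i (v i 0) ^+ 2).

Definition frob (C : 'M[R]_d) : R := Num.sqrt (\sum_i \sum_j (C i j) ^+ 2).

Definition grad (f : 'cV[R]_d -> R) (z : 'cV[R]_d) : 'cV[R]_d :=
  \col_i ('D_(delta_mx i 0 : 'cV[R]_d) f z).

Definition smooth_M (M : R) (f : 'cV[R]_d -> R) : Prop :=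
  forall y z : 'cV[R]_d, enorm (grad f y - grad f z) <= M * enorm (y - z).

Definition Tw (w : 'cV[R]_d * 'M[R]_d) (u : 'cV[R]_d) : 'cV[R]_d :=
  w.2 *m u + w.1.

Definition gradw_sqnorm (f : 'cV[R]_d -> R) (w : 'cV[R]_d * 'M[R]_d)
    (u : 'cV[R]_d) : R :=
  let F := fun w' : 'cV[R]_d * 'M[R]_d => f (Tw w' u) in
  \sum_i ('D_((delta_mx i 0 : 'cV[R]_d), (0 : 'M[R]_d)) F w) ^+ 2
  + \sum_i \sum_j ('D_((0 : 'cV[R]_d), (delta_mx i j : 'M[R]_d)) F w) ^+ 2.
End defs.

(* Mutual independence of a finite family of real random variables:
   product rule for every family of measurable sets (taking B i = setT
   recovers every finite subfamily). *)
Definition mutually_independent {dT} {T : measurableType dT} {R : realType}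
    (P : probability T R) (n : nat) (X : 'I_n -> T -> R) : Prop :=
  forall B : 'I_n -> set R, (forall i, measurable (B i)) ->
    P (\bigcap_(i in [set: 'I_n]) (X i @^-1` B i)) =
    (\prod_(i < n) P (X i @^-1` B i))%E.

Definition standardized_with_kurtosis {dT} {T : measurableType dT}
    {R : realType} (P : probability T R) (n : nat)
    (u : 'I_n -> T -> R) (kappa : R) : Prop :=
  [/\ (forall i, measurable_fun setT (u i)),
      mutually_independent P u,
      (forall i j (B : set R), measurable B ->
          P (u i @^-1` B) = P (u j @^-1` B)),
      (forall i, ('E_P[u i] = 0)%E /\ ('E_P[u i ^+ 3] = 0)%E) &
      (forall i, ('V_P[u i] = 1)%E /\ ('E_P[u i ^+ 4] = kappa%:E)%E)].

Definition rvec {T : Type} {R : realType} (n : nat) (u : 'I_n -> T -> R)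
    (t : T) : 'cV[R]_n := \col_i u i t.

(* Main.v *)
Require Import Defs.
From HB Require Import structures.
From mathcomp Require Import all_boot all_order all_algebra.
From mathcomp Require Import all_classical all_reals all_analysis.
From mathcomp Require Import measurable_realfun ring lra.
Import Order.TTheory GRing.Theory Num.Theory.
Import numFieldNormedType.Exports.
Local Open Scope classical_set_scope.
Local Open Scope ring_scope.

Set Implicit Arguments.
Unset Strict Implicit.

(** By the chain rule, the partial derivatives of [w |-> f (C u + m)] are those
    of [f] at [z = C u + m], together with their products with the entries of
    [u]; hence the squared norm of the gradient is
    [|grad f z|^2 (1 + |u|^2)].  Smoothness and stationarity give
    [|grad f z| <= M |z - zbar|], with equality for the quadratic function, so
    both claims reduce to the exact value of
    [E (|C u + m - zbar|^2 (1 + |u|^2))].  Expanding, only the moments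
    [E (u_j u_l)], [E (u_j u_k^2)] and [E (u_j u_l u_k^2)] occur; independence
    and the vanishing odd moments kill all of them except those with [j = l],
    where [E (u_j^2 |u|^2) = kappa + d - 1]. *)

(** * Monotonicity of the integral and independence of pairs *)

(** The integral of a nonnegative function is a supremum over the simple functions below it, and
    these sets of simple functions are nested. This applies to [gradw_sqnorm f], whose measurability
    is never established. *)
Lemma le_integral_nonmeasurable (dT : measure_display) (T : measurableType dT)
    (R : realType) (mu : {measure set T -> \bar R}) (f g : T -> \bar R) :
  (forall x, (0 <= f x)%E) -> (forall x, (f x <= g x)%E) ->
  (\int[mu]_x f x <= \int[mu]_x g x)%E.
Proof.
move=> f0 fg; have g0 x : (0 <= g x)%E by exact: le_trans (fg x).
rewrite !ge0_integralTE//; apply: le_ereal_sup => _ [h /= hf <-].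
by exists h => // x; exact: le_trans (fg x).
Qed.

(** The target spaces are arbitrary so that [Y] can be a pair of variables. *)
Definition indep_rv (dT d1 d2 : measure_display) (T : measurableType dT)
    (T1 : measurableType d1) (T2 : measurableType d2) (R : realType)
    (P : probability T R) (X : T -> T1) (Y : T -> T2) : Prop :=
  forall A B, measurable A -> measurable B ->
    P (X @^-1` A `&` Y @^-1` B) = (P (X @^-1` A) * P (Y @^-1` B))%E.

(** For fixed [A], the finite measures [m1] (the law of [(Y, Z)] restricted to the event [X] in [A])
    and [m2] (that law scaled by the probability of the event) agree on rectangles, which form a
    pi-system generating the product sigma-algebra. *)
Lemma indep_rv_pair (dT d1 d2 d3 : measure_display) (T : measurableType dT)
    (T1 : measurableType d1) (T2 : measurableType d2) (T3 : measurableType d3)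
    (R : realType) (P : probability T R)
    (X : T -> T1) (Y : T -> T2) (Z : T -> T3) :
  measurable_fun setT X -> measurable_fun setT Y -> measurable_fun setT Z ->
  (forall A B C, measurable A -> measurable B -> measurable C ->
    P (X @^-1` A `&` (Y @^-1` B `&` Z @^-1` C)) =
    (P (X @^-1` A) * P (Y @^-1` B `&` Z @^-1` C))%E) ->
  indep_rv P X (fun t => (Y t, Z t)).
Proof.
move=> mX mY mZ XYZ A D mA mD.
have mXA : measurable (X @^-1` A).
  by rewrite -[X in measurable X]setTI; exact: mX.
have mW : measurable_fun setT (fun t => (Y t, Z t)).
  exact: measurable_fun_pair.
pose W : {mfun T >-> (T2 * T3)%type} := mfun_Sub (mem_set mW).
have PA0 : 0 <= fine (P (X @^-1` A)) by rewrite fine_ge0.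
pose m1 : {measure set (T2 * T3) -> \bar R} := pushforward (mrestr P mXA) W.
pose m2 : {measure set (T2 * T3) -> \bar R} :=
  mscale (NngNum PA0) (distribution P W).
have PAE : P (X @^-1` A) = (fine (P (X @^-1` A)))%:E.
  by rewrite fineK ?fin_num_measure.
suff : m1 mW D = m2 D.
  rewrite /m1 /m2 /= /pushforward /mrestr /mscale /=.
  rewrite /distribution /pushforward /=.
  by rewrite -PAE setIC.
apply: (@measure_unique _ _ _ [set B `*` C | B in measurable & C in measurable]
  (fun=> setT) _ _ _ _ (m1 mW)) => //.
- exact: measurable_prod_measurableType.
- move=> _ _ [B1 mB1 [C1 mC1 <-]] [B2 mB2 [C2 mC2 <-]].
  rewrite -setXI; exists (B1 `&` B2); first exact: measurableI.
  by exists (C1 `&` C2) => //; exact: measurableI.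
- by move=> _; exists setT => //; exists setT => //; rewrite setXTT.
- by rewrite bigcup_const.
- move=> _ [B mB [C mC <-]].
  rewrite /m1 /m2 /= /pushforward /mrestr /mscale /=.
  rewrite /distribution /pushforward /=.
  by rewrite -PAE -XYZ// setIC.
- move=> _; rewrite /m1 /= /pushforward /mrestr.
  apply: le_lt_trans (ltry 1); apply: probability_le1.
  by rewrite preimage_setT setTI.
Qed.

(** * Expectations of real variables, and independence *)

Section mean.
Variables (dT : measure_display) (T : measurableType dT) (R : realType).
Variable (P : probability T R).

(** Integrability and the finite value travel together, so that linearity applies without side
    conditions. *)
Definition has_mean (X : T -> R) (a : R) : Prop :=
  P.-integrable setT (EFin \o X) /\ (\int[P]_t (X t)%:E = a%:E)%E.

Lemma eq_has_mean (Y X : T -> R) (a b : R) :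
  X =1 Y -> a = b -> has_mean X a -> has_mean Y b.
Proof. by move=> /funext -> ->. Qed.

Lemma has_mean_cst (c : R) : has_mean (fun=> c) c.
Proof.
split; last by rewrite integral_cst//= probability_setT mule1.
exact: finite_measure_integrable_cst.
Qed.

Lemma has_meanD (X Y : T -> R) (a b : R) :
  has_mean X a -> has_mean Y b -> has_mean (fun t => X t + Y t) (a + b).
Proof.
move=> [iX EX] [iY EY]; split.
  by have := integrableD measurableT iX iY; apply: eq_integrable.
under eq_integral do rewrite EFinD.
by rewrite integralD// EX EY.
Qed.

Lemma has_meanZ (c : R) (X : T -> R) (a : R) :
  has_mean X a -> has_mean (fun t => c * X t) (c * a).
Proof.
move=> [iX EX]; split.
  by have := integrableZl measurableT c iX; apply: eq_integrable.
under eq_integral do rewrite EFinM.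
by rewrite integralZl// EX.
Qed.

Lemma has_mean_sum (I : Type) (s : seq I) (Q : pred I) (X : I -> T -> R)
    (a : I -> R) :
  (forall i, has_mean (X i) (a i)) ->
  has_mean (fun t => \sum_(i <- s | Q i) X i t) (\sum_(i <- s | Q i) a i).
Proof.
move=> HX; elim: s => [|i s IH].
  by rewrite big_nil; under eq_fun do rewrite big_nil; exact: has_mean_cst.
rewrite big_cons; under eq_fun do rewrite big_cons.
by case: (Q i) => //; exact: has_meanD.
Qed.

Lemma integrable_le (X Y : T -> R) : measurable_fun setT X ->
  (forall t, `|X t| <= Y t) -> P.-integrable setT (EFin \o Y) ->
  P.-integrable setT (EFin \o X).
Proof.
move=> mX XY iY; apply: (le_integrable measurableT) iY.
  exact/measurable_EFinP.
by move=> t _ /=; rewrite lee_fin (le_trans (XY t))// ler_norm.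
Qed.

(** By independence the law of [(X, Y)] is the product of the two laws, and Fubini's theorem splits
    the integral. *)
Lemma indep_rv_has_mean (d1 d2 : measure_display) (T1 : measurableType d1)
    (T2 : measurableType d2) (X : T -> T1) (Y : T -> T2)
    (g : T1 -> R) (h : T2 -> R) (a b : R) :
  measurable_fun setT X -> measurable_fun setT Y ->
  measurable_fun setT g -> measurable_fun setT h ->
  indep_rv P X Y ->
  P.-integrable setT (EFin \o (fun t => g (X t) * h (Y t))) ->
  has_mean (g \o X) a -> has_mean (h \o Y) b ->
  has_mean (fun t => g (X t) * h (Y t)) (a * b).
Proof.
move=> mX mY mg mh XY igh [ig Eg] [ih Eh]; split => //.
have mW : measurable_fun setT (fun t => (X t, Y t)).
  exact: measurable_fun_pair.
pose X' : {mfun T >-> T1} := mfun_Sub (mem_set mX).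
pose Y' : {mfun T >-> T2} := mfun_Sub (mem_set mY).
pose W : {mfun T >-> (T1 * T2)%type} := mfun_Sub (mem_set mW).
pose F (z : T1 * T2) := (g z.1 * h z.2)%:E.
have mF : measurable_fun setT F.
  apply/measurable_EFinP; apply: measurable_funM.
    exact: measurableT_comp mg measurable_fst.
  exact: measurableT_comp mh measurable_snd.
have prodE A : measurable A ->
    (distribution P X' \x distribution P Y')%E A = distribution P W A.
  by move=> mA; apply: product_measure_unique => // B C mB mC; exact: XY.
have iF : (distribution P X' \x distribution P Y')%E.-integrable setT F.
  have : (distribution P W).-integrable setT F by exact: integrable_pushforward.
  move=> /integrableP[_ Foo]; apply/integrableP; split => //.
  by rewrite (eq_measure_integral (distribution P W))// => A mA _; exact: prodE.
transitivity (\int[distribution P W]_z F z)%E.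
  by rewrite integral_distribution.
rewrite -(eq_measure_integral (distribution P W)
  (m1 := (distribution P X' \x distribution P Y')%E)); last first.
  by move=> A mA _; exact: prodE.
rewrite -integral12_prod_meas1//.
have EY : (\int[distribution P Y']_y (h y)%:E = b%:E)%E.
  by rewrite integral_distribution//; exact/measurable_EFinP.
have iY : (distribution P Y').-integrable setT (EFin \o h).
  by apply: integrable_pushforward => //; exact/measurable_EFinP.
(* The inner integral over [y] is [g x] times the constant [b]. *)
transitivity (\int[distribution P X']_x ((g x)%:E * b%:E))%E.
  by apply: eq_integral => x _; rewrite /fubini_F -EY -integralZl.
rewrite integralZr//; last first.
  by apply: integrable_pushforward => //; exact/measurable_EFinP.
rewrite integral_distribution//; last exact/measurable_EFinP.
by rewrite EFinM -Eg.
Qed.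

End mean.

Lemma mutually_independent_pair (dT : measure_display) (T : measurableType dT)
    (R : realType) (P : probability T R) (n : nat) (u : 'I_n -> T -> R)
    (j l k : 'I_n) :
  (forall i, measurable_fun setT (u i)) -> mutually_independent P u ->
  j != l -> j != k -> indep_rv P (u j) (fun t => (u l t, u k t)).
Proof.
move=> mu indu jl jk; apply: indep_rv_pair => // A B C mA mB mC.
(* Mutual independence is stated for one set per index, hence [setT] at the remaining indices. The
   two constraints are intersected because [l] and [k] may coincide. *)
pose G i := (if i == l then B else setT) `&` (if i == k then C else setT).
pose F i := (if i == j then A else setT) `&` G i.
have mG i : measurable (G i) by apply: measurableI; case: ifP.
have mF i : measurable (F i) by apply: measurableI => //; case: ifP.
have GE : \bigcap_(i in [set: 'I_n]) (u i @^-1` G i) =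
    u l @^-1` B `&` u k @^-1` C.
  apply/seteqP; split=> t.
    move=> Gt; split.
      by have := Gt l I; rewrite /preimage /G /= eqxx => -[].
    by have := Gt k I; rewrite /preimage /G /= eqxx => -[].
  by move=> [/= Bt Ct] i _; split; case: eqP => // ->.
have FE : \bigcap_(i in [set: 'I_n]) (u i @^-1` F i) =
    u j @^-1` A `&` (u l @^-1` B `&` u k @^-1` C).
  rewrite -GE; apply/seteqP; split=> t.
    move=> Ft; split; last by move=> i _; have [] := Ft i I.
    by have := Ft j I; rewrite /preimage /F /= eqxx => -[].
  by move=> [/= At Gt] i _; split; [case: eqP => // ->|exact: Gt].
(* The two products differ only in the factor at [j], where [F] has [A] and [G] has the whole
   space. *)
rewrite -FE -GE !indu// (bigD1 j)//= [in RHS](bigD1 j)//=.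
have -> : G j = setT by rewrite /G (negbTE jl) (negbTE jk) setIT.
have -> : F j = A by rewrite /F /G eqxx (negbTE jl) (negbTE jk) !setIT.
rewrite preimage_setT probability_setT mul1e; congr (_ * _)%E.
by apply: eq_bigr => i /negbTE ij; rewrite /F ij setTI.
Qed.

(** * Moments of a standardized family up to order four *)

Section moments.
Variables (dT : measure_display) (T : measurableType dT) (R : realType).
Variables (P : probability T R) (d : nat) (u : 'I_d -> T -> R) (kappa : R).
Hypothesis stdu : standardized_with_kurtosis P u kappa.

Let mu i : measurable_fun setT (u i). Proof. by case: stdu. Qed.

(** A fourth power is nonnegative, so the finite value [kappa] already gives integrability. All
    later integrability facts go back to this one by domination. *)
Let mean4 i : has_mean P (fun t => u i t ^+ 4) kappa.
Proof.
have [_ _ _ _ /(_ i)[_]] := stdu; rewrite unlock => E4.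
split => //; apply/integrableP; split.
  by apply/measurable_EFinP; exact: measurable_funX.
rewrite (_ : (\int[P]_x _)%E = kappa%:E) ?ltry// -E4.
apply: eq_integral => t _ /=; rewrite ger0_norm//.
by rewrite (exprM _ 2 2) sqr_ge0.
Qed.

Lemma integrable_quartic_monomial (j l k : 'I_d) :
  P.-integrable setT (EFin \o (fun t => u j t * u l t * u k t ^+ 2)).
Proof.
apply: (@integrable_le _ _ _ _ _
  (fun t => u j t ^+ 4 + u l t ^+ 4 + u k t ^+ 4)).
- by apply: measurable_funM; [exact: measurable_funM|exact: measurable_funX].
- move=> t; rewrite ler_norml; move: (u j t) (u l t) (u k t) => x y z.
  (* Squares behind [|x y z^2| <= (x^2 y^2 + z^4) / 2] and [x^2 y^2 <= (x^4 + y^4) / 2]. *)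
  have := sqr_ge0 (x * y + z ^+ 2); have := sqr_ge0 (x * y - z ^+ 2).
  have := sqr_ge0 (x ^+ 2 - y ^+ 2); have := sqr_ge0 (x ^+ 2).
  have := sqr_ge0 (y ^+ 2); have := sqr_ge0 (z ^+ 2).
  by move=> *; apply/andP; split; nra.
- exact: (has_meanD (has_meanD (mean4 j) (mean4 l)) (mean4 k)).1.
Qed.

Let integrable_pow i n : (n <= 4)%N ->
  P.-integrable setT (EFin \o (fun t => u i t ^+ n)).
Proof.
move=> n4; apply: (@integrable_le _ _ _ _ _ (fun t => 1 + u i t ^+ 4)).
- exact: measurable_funX.
- move=> t; rewrite normrX -[u i t ^+ 4]ger0_norm; last first.
    by rewrite (exprM _ 2 2) sqr_ge0.
  rewrite normrX; have := normr_ge0 (u i t); move: `|u i t| => x x0.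
  have [x1|/ltW x1] := leP x 1.
    by rewrite (le_trans (exprn_ile1 _ x0 x1))// lerDl exprn_ge0.
  by rewrite (le_trans (ler_weXn2l x1 n4))// lerDr.
- exact: (has_meanD (has_mean_cst P 1) (mean4 i)).1.
Qed.

Let mean1 i : has_mean P (u i) 0.
Proof.
have [_ _ _ /(_ i)[+ _] _] := stdu; rewrite unlock => E1.
by split => //; exact: (integrable_pow i (n := 1)).
Qed.

Let mean2 i : has_mean P (fun t => u i t ^+ 2) 1.
Proof.
split; first exact: integrable_pow.
have [_ _ _ /(_ i)[E1 _] /(_ i)[+ _]] := stdu.
rewrite /variance covariance.unlock E1 /= expectation.unlock => <-.
by apply: eq_integral => t _ /=; rewrite !fctE /= subr0 expr2.
Qed.

Let mean3 i : has_mean P (fun t => u i t ^+ 3) 0.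
Proof.
have [_ _ _ /(_ i)[_ +] _] := stdu; rewrite unlock => E3.
by split => //; exact: integrable_pow.
Qed.

(** Mixed moments are computed by isolating one index [j]; taking [l = k] covers monomials in two
    variables. *)
Let mean_pair (g : R -> R) (h : R * R -> R) (j l k : 'I_d) (a b : R) :
  measurable_fun setT g -> measurable_fun setT h ->
  j != l -> j != k ->
  P.-integrable setT (EFin \o (fun t => g (u j t) * h (u l t, u k t))) ->
  has_mean P (fun t => g (u j t)) a ->
  has_mean P (fun t => h (u l t, u k t)) b ->
  has_mean P (fun t => g (u j t) * h (u l t, u k t)) (a * b).
Proof.
move=> mg mh jl jk igh Eg Eh.
apply: (@indep_rv_has_mean _ _ _ _ _ _ _ _
  (u j) (fun t => (u l t, u k t)) g h) => //.
  exact: measurable_fun_pair.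
by apply: mutually_independent_pair => //; case: stdu.
Qed.

Lemma mean_cubic (j k : 'I_d) : has_mean P (fun t => u j t * u k t ^+ 2) 0.
Proof.
have [->|jk] := eqVneq j k.
  by apply: eq_has_mean (mean3 k) => // t; rewrite exprS.
have mh : measurable_fun setT (fun z : R * R => z.2 ^+ 2 : R).
  by apply: measurable_funX; exact: measurable_snd.
apply: eq_has_mean (mean_pair (g := id) (h := fun z => z.2 ^+ 2) (j := j)
  (l := k) (k := k) (@measurable_id _ _ _) mh jk jk _ (mean1 j)
  (mean2 k)) => //.
  by rewrite mul0r.
apply: (@integrable_le _ _ _ _ _ (fun t => u j t ^+ 2 + u k t ^+ 4)).
- by move=> /=; apply: measurable_funM => //; exact: measurable_funX.
- move=> t /=; rewrite ler_norml; move: (u j t) (u k t) => x z.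
  have := sqr_ge0 (x + z ^+ 2); have := sqr_ge0 (x - z ^+ 2).
  have := sqr_ge0 x; have := sqr_ge0 (z ^+ 2).
  by move=> *; apply/andP; split; nra.
- exact: (has_meanD (mean2 j) (mean4 k)).1.
Qed.

(** If [j = l], the monomial is a fourth power or a product of two independent squares. Otherwise a
    factor of mean zero splits off: [u l] when [k = j], and [u j] when [k] differs from [j]. *)
Lemma mean_quartic (j l k : 'I_d) :
  has_mean P (fun t => u j t * u l t * u k t ^+ 2)
    (if j == l then if k == j then kappa else 1 else 0).
Proof.
have igh := @integrable_quartic_monomial j l k.
have mh : measurable_fun setT (fun z : R * R => z.1 * z.2 ^+ 2 : R).
  apply: measurable_funM; first exact: measurable_fst.
  by apply: measurable_funX; exact: measurable_snd.
have mh2 : measurable_fun setT (fun z : R * R => z.2 ^+ 2 : R).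
  by apply: measurable_funX; exact: measurable_snd.
have [jl|jl] := eqVneq j l.
  subst l; have [->|kj] := eqVneq k j.
    by apply: eq_has_mean (mean4 j) => // t; rewrite -expr2 -exprD.
  have jk : j != k by rewrite eq_sym.
  have mg : measurable_fun setT (fun x : R => x ^+ 2) by exact: measurable_funX.
  apply: eq_has_mean (mean_pair (g := fun x => x ^+ 2) (h := fun z => z.2 ^+ 2)
    (j := j) (l := k) (k := k) mg mh2 jk jk _ (mean2 j) (mean2 k)).
  - by move=> t; rewrite -expr2.
  - by rewrite mulr1.
  - by apply: eq_integrable igh => // t _ /=; rewrite -expr2.
have [kj|kj] := eqVneq k j.
  subst k.
  have mg : measurable_fun setT (fun x : R => x ^+ 3) by exact: measurable_funX.
  apply: eq_has_mean (mean_pair (g := fun x => x ^+ 3) (h := fun z => z.1)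
    (j := j) (l := l) (k := l) mg measurable_fst jl jl _ (mean3 j) (mean1 l)).
  - by move=> t /=; ring.
  - by rewrite mulr0.
  - by apply: eq_integrable igh => // t _ /=; congr EFin; ring.
have jk : j != k by rewrite eq_sym.
(* Here [k = l] is possible, in which case [mean_cubic] supplies the third moment. *)
apply: eq_has_mean (mean_pair (g := id) (h := fun z => z.1 * z.2 ^+ 2)
  (j := j) (l := l) (k := k) (@measurable_id _ _ _) mh jl jk _ (mean1 j)
  (mean_cubic l k)).
- by move=> t /=; rewrite mulrA.
- by rewrite mulr0.
- by apply: eq_integrable igh => // t _ /=; rewrite mulrA.
Qed.

Lemma mean_quadratic (j l : 'I_d) :
  has_mean P (fun t => u j t * u l t) (if j == l then 1 else 0).
Proof.
have [->|jl] := eqVneq j l.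
  by apply: eq_has_mean (mean2 l) => // t; rewrite expr2.
apply: eq_has_mean (mean_pair (g := id) (h := fun z => z.1)
  (j := j) (l := l) (k := l) (@measurable_id _ _ _) measurable_fst jl jl _ (mean1 j)
  (mean1 l)) => //; first by rewrite mulr0.
apply: (@integrable_le _ _ _ _ _ (fun t => u j t ^+ 2 + u l t ^+ 2)).
- by move=> /=; exact: measurable_funM.
- move=> t /=; rewrite ler_norml; move: (u j t) (u l t) => x y.
  have := sqr_ge0 (x + y); have := sqr_ge0 (x - y).
  by move=> *; apply/andP; split; nra.
- exact: (has_meanD (mean2 j) (mean2 l)).1.
Qed.

(** This is the factor [1 + |u|^2] of the squared gradient norm. *)
Let S t := 1 + \sum_k u k t ^+ 2.

Let mean_S : has_mean P S (d%:R + 1).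
Proof.
rewrite addrC; apply: has_meanD; first exact: has_mean_cst.
apply: eq_has_mean (has_mean_sum _ _ mean2) => //.
by rewrite sumr_const card_ord.
Qed.

Let mean_uS j : has_mean P (fun t => u j t * S t) 0.
Proof.
apply: eq_has_mean (has_meanD (mean1 j) (has_mean_sum _ _ (mean_cubic j))).
- by move=> t; rewrite /S mulrDr mulr1 mulr_sumr.
- by rewrite add0r big1.
Qed.

Let mean_uuS j l : has_mean P (fun t => u j t * u l t * S t)
  (if j == l then d%:R + kappa else 0).
Proof.
apply: eq_has_mean (has_meanD (mean_quadratic j l)
  (has_mean_sum _ _ (mean_quartic j l))).
- by move=> t; rewrite /S mulrDr mulr1 mulr_sumr.
case: eqP => _; last by rewrite add0r big1.
(* The total is [1 + kappa + (d - 1)]: the quadratic moment, the term [k = j], and the others. *)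
rewrite (bigD1 j)//= eqxx.
rewrite (eq_bigr (fun=> 1)) => [|k /negbTE ->//].
rewrite addrCA sumr_const addrC; congr (_ + _).
rewrite cardC1 card_ord nat1r prednK//.
(* The index [j] inhabits ['I_d], so [d] is positive and its predecessor is not truncated. *)
by case: d j => [[]|].
Qed.

(** This treats one coordinate of [C u + m - zbar], with [c] a row of [C] and [a] an entry of
    [m - zbar]. After expansion of the square, the cross terms in [a] have mean zero and the double
    sum keeps its diagonal. *)
Lemma mean_affine_sqr (c : 'I_d -> R) (a : R) :
  has_mean P (fun t => (\sum_j c j * u j t + a) ^+ 2 * S t)
    ((d%:R + kappa) * (\sum_j c j ^+ 2) + (d%:R + 1) * a ^+ 2).
Proof.
have H1 := has_mean_sum (index_enum _) xpredT (fun j =>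
  has_mean_sum (index_enum _) xpredT (fun l =>
    has_meanZ (c j * c l) (mean_uuS j l))).
have H2 := has_mean_sum (index_enum _) xpredT (fun j =>
  has_meanZ (2 * a * c j) (mean_uS j)).
have H3 := has_meanZ (a ^+ 2) mean_S.
apply: eq_has_mean (has_meanD (has_meanD H1 H2) H3).
- move=> t /=; rewrite sqrrD [RHS]mulrDl [X in _ = X + _]mulrDl; congr (_ + _ + _).
    rewrite expr2 mulr_suml mulr_suml; apply: eq_bigr => j _.
    rewrite mulr_sumr mulr_suml; apply: eq_bigr => l _; ring.
  rewrite mulr_suml -sumrMnl mulr_suml; apply: eq_bigr => j _; ring.
- rewrite [X in _ + X + _]big1 ?addr0; last by move=> j _; rewrite mulr0.
  rewrite [RHS]addrC addrC [a ^+ 2 * _]mulrC mulr_sumr; congr (_ + _).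
  apply: eq_bigr => j _; rewrite (bigD1 j)//= eqxx big1 ?addr0.
    by rewrite mulrC expr2.
  by move=> l /negbTE lj; rewrite eq_sym lj mulr0.
Qed.

End moments.

(** * Norms, the common majorant and the gradient in [w] *)

Lemma enorm_sqr (R : realType) (d : nat) (v : 'cV[R]_d) :
  enorm v ^+ 2 = \sum_i v i 0 ^+ 2.
Proof. by rewrite sqr_sqrtr// sumr_ge0// => i _; exact: sqr_ge0. Qed.

Lemma frob_sqr (R : realType) (d : nat) (C : 'M[R]_d) :
  frob C ^+ 2 = \sum_i \sum_j C i j ^+ 2.
Proof.
rewrite sqr_sqrtr// sumr_ge0// => i _.
by rewrite sumr_ge0// => j _; exact: sqr_ge0.
Qed.

Lemma enormZ (R : realType) (d : nat) (a : R) (v : 'cV[R]_d) :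
  0 <= a -> enorm (a *: v) = a * enorm v.
Proof.
move=> a0; rewrite /enorm -{2}(ger0_norm a0) -sqrtr_sqr -sqrtrM ?sqr_ge0//.
by rewrite mulr_sumr; congr Num.sqrt; apply: eq_bigr => i _; rewrite mxE exprMn.
Qed.

(** The integrand dominates the squared gradient norm in general and equals it for the quadratic
    function. Its mean is the sum of [mean_affine_sqr] over the rows of [C]. *)
Lemma mean_smoothness_bound (dT : measure_display) (T : measurableType dT)
    (R : realType) (P : probability T R) (d : nat) (u : 'I_d -> T -> R)
    (kappa M : R) (m zbar : 'cV[R]_d) (C : 'M[R]_d) :
  standardized_with_kurtosis P u kappa ->
  has_mean P (fun t => M ^+ 2 * enorm (Tw (m, C) (rvec u t) - zbar) ^+ 2 *
                       (1 + enorm (rvec u t) ^+ 2))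
    (M ^+ 2 * ((d%:R + 1) * enorm (m - zbar) ^+ 2
               + (d%:R + kappa) * frob C ^+ 2)).
Proof.
move=> stdu.
have H := has_meanZ (M ^+ 2) (has_mean_sum (index_enum _) xpredT
  (fun i => mean_affine_sqr stdu (C i) ((m - zbar) i 0))).
apply: eq_has_mean H.
  move=> t /=; rewrite -mulrA; congr (_ * _).
  rewrite !enorm_sqr mulr_suml; apply: eq_bigr => i _.
  under [in RHS]eq_bigr do rewrite mxE.
  congr (_ ^+ 2 * _); rewrite /Tw /= !mxE addrA; congr (_ + _ + _).
  by apply: eq_bigr => j _; rewrite mxE.
by rewrite big_split/= -!mulr_sumr enorm_sqr frob_sqr addrC.
Qed.

Lemma gradw_sqnormE (R : realType) (d : nat) (f : 'cV[R]_d -> R)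
    (w : 'cV[R]_d * 'M[R]_d) (u : 'cV[R]_d) :
  differentiable f (Tw w u) ->
  gradw_sqnorm f w u = enorm (grad f (Tw w u)) ^+ 2 * (1 + enorm u ^+ 2).
Proof.
move=> df.
(* [Tw] is affine in [w], so both difference quotients coincide. *)
have DE v : 'D_v (fun w' => f (Tw w' u)) w = 'D_(v.2 *m u + v.1) f (Tw w u).
  apply: (congr1 (fun g => lim (g @ 0^'))); apply/funext => h /=.
  congr (_ *: (f _ - _)).
  by rewrite /Tw /= mulmxDl -scalemxAl scalerDr addrACA.
rewrite /gradw_sqnorm mulrDr mulr1 !enorm_sqr; congr (_ + _).
  by apply: eq_bigr => i _; rewrite DE /= mul0mx add0r mxE.
rewrite mulr_suml; apply: eq_bigr => i _.
rewrite mulr_sumr; apply: eq_bigr => j _; rewrite DE /= addr0 mxE.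
(* Perturbing the entry [(i, j)] of the matrix moves [Tw w u] along the [i]-th basis vector, scaled
   by [u j 0]. *)
have -> : delta_mx i j *m u = u j 0 *: (delta_mx i 0 : 'cV[R]_d).
  apply/matrixP => k l; rewrite !mxE (bigD1 j)//= !mxE eqxx andbT.
  rewrite big1 ?addr0; last first.
    by move=> r /negbTE rj; rewrite !mxE rj andbF mul0r.
  by rewrite !ord1 eqxx andbT mulrC.
(* Differentiability makes the directional derivative linear in the direction, which frees the
   scalar [u j 0]. *)
by rewrite !deriveE// linearZ /= exprMn mulrC.
Qed.

Lemma is_derive_coord (R : realType) (d : nat) (z v : 'cV[R]_d) (i : 'I_d) :
  is_derive z v (fun z : 'cV[R]_d => z i 0) (v i 0).
Proof.
split; first exact/diff_derivable/differentiable_coord.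
have := @derive_mx R 'cV[R]_d d 1 id z v (@derivable_id _ _ _ _).
by rewrite derive_id => /matrixP/(_ i 0); rewrite mxE.
Qed.

(** * The extremal quadratic function *)

Section quadratic.
Variables (R : realType) (d : nat) (M : R) (zbar : 'cV[R]_d).
Let f := fun z : 'cV[R]_d => M / 2 * enorm (z - zbar) ^+ 2.

(** A form built from operations on functions, to which the differentiation rules apply directly. *)
Let fE : f =
  (M / 2) \*: (\sum_(i < d) (fun z : 'cV[R]_d => z i 0 - zbar i 0) ^+ 2).
Proof.
apply/funext => z; rewrite /f enorm_sqr fct_sumE /=; congr (_ * _).
by apply: eq_bigr => i _; rewrite !mxE.
Qed.

Lemma differentiable_quadratic z : differentiable f z.
Proof.
rewrite fE; apply: differentiableZ; apply: differentiable_sum => i.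
apply: differentiableX; apply: differentiableB => //.
exact: differentiable_coord.
Qed.

Lemma grad_quadratic z : grad f z = M *: (z - zbar).
Proof.
apply/matrixP => i j; rewrite !mxE ord1 fE.
have H k : is_derive z (delta_mx i 0 : 'cV[R]_d)
    ((fun z : 'cV[R]_d => z k 0 - zbar k 0) ^+ 2)
    ((z k 0 - zbar k 0) *+ 2 * (k == i)%:R).
  have Hk := is_deriveB (is_derive_coord z (delta_mx i 0) k)
    (is_derive_cst (zbar k 0) z (delta_mx i 0 : 'cV[R]_d)).
  apply: is_derive_eq (is_deriveX 2 Hk) _.
  by rewrite !mxE eqxx andbT subr0 expr1 mulr_natl.
rewrite (@derive_val _ _ _ _ _ _ _ (is_deriveZ (M / 2) (is_derive_sum H))).
rewrite (bigD1 i)//= eqxx big1 => [|k /negbTE ->]; last by rewrite mulr0.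
by rewrite addr0 mulr1 /GRing.scale /=; field.
Qed.

(** The gradient is [M] times a translation, so the smoothness inequality is an equality. *)
Lemma smooth_quadratic : 0 <= M -> smooth_M M f.
Proof.
by move=> M0 y z; rewrite !grad_quadratic -scalerBr opprB addrA subrK enormZ.
Qed.

End quadratic.

(** * The bound and its attainment *)

Theorem theorem1 (R : realType) (d : nat) :
  (forall (f : 'cV[R]_d -> R) (M : R) (zbar : 'cV[R]_d),
     (forall z, differentiable f z) -> 0 <= M -> smooth_M M f ->
     grad f zbar = 0 ->
     forall (dT : measure_display) (T : measurableType dT)
            (P : probability T R) (u : 'I_d -> T -> R) (kappa : R),
     standardized_with_kurtosis P u kappa ->
     forall (m : 'cV[R]_d) (C : 'M[R]_d),
     (\int[P]_t (gradw_sqnorm f (m, C) (rvec u t))%:E <=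
       (M ^+ 2 * ((d%:R + 1) * enorm (m - zbar) ^+ 2
                  + (d%:R + kappa) * frob C ^+ 2))%:E)%E)
  /\
  (forall (M : R) (zbar : 'cV[R]_d),
     0 <= M ->
     let f := fun z : 'cV[R]_d => M / 2 * enorm (z - zbar) ^+ 2 in
     [/\ (forall z, differentiable f z), smooth_M M f, grad f zbar = 0 &
     forall (dT : measure_display) (T : measurableType dT)
            (P : probability T R) (u : 'I_d -> T -> R) (kappa : R),
     standardized_with_kurtosis P u kappa ->
     forall (m : 'cV[R]_d) (C : 'M[R]_d),
     (\int[P]_t (gradw_sqnorm f (m, C) (rvec u t))%:E =
       (M ^+ 2 * ((d%:R + 1) * enorm (m - zbar) ^+ 2
                  + (d%:R + kappa) * frob C ^+ 2))%:E)%E]).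
Proof.
split=> [f M zbar df M0 sf gf0 dT T P u kappa stdu m C|M zbar M0 f].
  (* The right-hand side becomes the integral of the majorant, so a pointwise comparison
     suffices. *)
  have [_ <-] := mean_smoothness_bound M m zbar C stdu.
  apply: le_integral_nonmeasurable => t; rewrite lee_fin gradw_sqnormE//.
    by rewrite mulr_ge0 ?addr_ge0 ?sqr_ge0.
  rewrite ler_wpM2r ?addr_ge0 ?sqr_ge0// -exprMn.
  rewrite lerXn2r ?nnegrE ?mulr_ge0 ?sqrtr_ge0//.
  (* Smoothness between [Tw (m, C) (rvec u t)] and the stationary point bounds the gradient
     itself. *)
  by have := sf (Tw (m, C) (rvec u t)) zbar; rewrite gf0 subr0.
split.
- exact: differentiable_quadratic.
- exact: smooth_quadratic.
- by rewrite grad_quadratic subrr scaler0.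
move=> dT T P u kappa stdu m C.
have [_ <-] := mean_smoothness_bound M m zbar C stdu.
apply: eq_integral => t _.
rewrite gradw_sqnormE; last exact: differentiable_quadratic.
by rewrite grad_quadratic enormZ// exprMn.
Qed.
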